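(* Fix $k,\ell \in \mathbb{N}$. Then there exist real numbers $m,M > 0$ such that $$m\, \ell^{\,n/k} \leq \boldsymbol{q}_{k}(\mathcal{T}_\ell(n)) \leq f_{k,\ell}(n) \leq M\, \ell^{\,n/k}$$ for all $n \in \mathbb{N}$, where $$f_{k,\ell}(n) := \sum_{i=0}^{\lceil n/k \rceil-1} \ell^i + \sum_{j=1}^{k-1} \ell^{\lceil (n-j)/k\rceil}.$$ Thus $\boldsymbol{q}_{k}(\mathcal{T}_\ell(n)) = \Theta(\ell^{\,n/k})$ and $f_{k,\ell}(n)=\Theta(\ell^{\,n/k})$ as functions of $n$.
   Context: $\mathbb{N}=\mathbb{Z}_{>0}$. $\mathcal{T}_\ell(n)$ denotes the complete $\ell$-ary tree of height $n$, as a poset with the root as its unique minimal element: it has exactly $\ell^{t-1}$ nodes at level $t$ for each $t\in\{1,\dots,n\}$, every node at level less than $n$ is covered by exactly $\ell$ nodes, and the set of elements below any given node is a chain. For a finite poset $\lambda$ and $v\in\lambda$, let $\lambda_{\preccurlyeq v}=\{u\in\lambda\mid u\preccurlyeq v\}$. An ideal of $\lambda$ is a subset equal to $\varnothing$ or to $\lambda_{\preccurlyeq v}$ for some $v\in\lambda$. Hidden ideal problem: $\lambda$ is known and $\mu$ is an unknown (possibly empty) ideal of $\lambda$. One sequentially (adaptively) queries elements $v\in\lambda$, learning whether $v\in\mu$ (positive) or $v\notin\mu$ (negative), under the restriction that at most $k$ positive query results are permitted. $\boldsymbol{q}_k(\lambda)$ is the minimum total number of queries needed to guarantee identification of $\mu$: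 i.e. the least $N$ such that some adaptive query strategy, for every ideal $\mu$ of $\lambda$, identifies $\mu$ using at most $N$ queries in total, at most $k$ of which are positive.
   Formalization: The bound f_{k,ℓ}(n) ≤ M ℓ^{n/k} and both Θ claims are stated only for ℓ ≥ 2, since for ℓ = 1 they fail: f_{k,1}(n) = ⌈n/k⌉ + k − 1 and q_k of a chain are unbounded; the other inequalities are kept for all ℓ ≥ 1. *)

(* Defs.v *)
From HB Require Import structures.
From mathcomp Require Import all_boot all_order all_algebra.
From mathcomp Require Import all_classical all_reals all_analysis.

Set Implicit Arguments.
Unset Strict Implicit.
Unset Printing Implicit Defensive.

Import Order.TTheory GRing.Theory Num.Theory.
Import numFieldNormedType.Exports.

(* A node at level t (the root being at level 1) is encoded by the sequence of
   the t - 1 child choices on the path from the root to it, so that the order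
   is the prefix order and the height n bounds the length by n - 1. For n = 0
   this degenerates to a single node; only 0 < n is meaningful. *)
Definition ltree (l n : nat) : Type := n.-1.-bseq 'I_l.

HB.instance Definition _ (l n : nat) := Finite.on (ltree l n).

Definition ltree_le (l n : nat) : rel (ltree l n) :=
  fun u v => prefix (val u) (val v).

Fact ltree_le_refl l n : reflexive (@ltree_le l n).
Proof. by move=> u; exact: prefix_refl. Qed.

Fact ltree_le_anti l n : antisymmetric (@ltree_le l n).
Proof.
move=> u v /andP[]; rewrite /ltree_le => uv vu; apply: val_inj => /=.
have eq_sz : size (val u) = size (val v).
  by apply/eqP; rewrite eqn_leq !size_prefix.
by move: uv; rewrite prefixE eq_sz take_size => /eqP.
Qed.

Fact ltree_le_trans l n : transitive (@ltree_le l n).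
Proof. by move=> v u w; exact: prefix_trans. Qed.

Fact ltree_display : Order.disp_t. Proof. exact: Order.Disp tt tt. Qed.

HB.instance Definition _ (l n : nat) :=
  Order.Le_isPOrder.Build ltree_display (ltree l n)
    (@ltree_le_refl l n) (@ltree_le_anti l n) (@ltree_le_trans l n).

Lemma ltree_leE l n (u v : ltree l n) :
  (u <= v)%O = prefix (val u) (val v).
Proof. by []. Qed.

Section HiddenIdeal.
Context {d : Order.disp_t} (T : finPOrderType d).
Implicit Types (mu : {set T}) (k N : nat).

Definition below (v : T) : {set T} := [set u | (u <= v)%O].

Definition is_ideal mu : Prop := mu = finset.set0 \/ exists v, mu = below v.

(* Adaptive strategies are decision trees: stop and announce a set, or query an
   element and continue according to the answer. *)
Inductive strategy : Type :=
| Announce of {set T}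
| Query (v : T) (if_in if_out : strategy).

Fixpoint announced (s : strategy) mu : {set T} :=
  match s with
  | Announce A => A
  | Query v s1 s0 => announced (if v \in mu then s1 else s0) mu
  end.

Fixpoint answers (s : strategy) mu : seq bool :=
  match s with
  | Announce _ => [::]
  | Query v s1 s0 => (v \in mu) :: answers (if v \in mu then s1 else s0) mu
  end.

Definition identifies k N (s : strategy) : Prop :=
  forall mu, is_ideal mu ->
    [/\ announced s mu = mu,
        (size (answers s mu) <= N)%N &
        (count id (answers s mu) <= k)%N].

Definition identifiable k N : Prop := exists s, identifies k N s.

(* The default value 0 is only reached for k = 0: see query_numberP. *)
Definition query_number k : nat :=
  xget 0%N [set N | identifiable k N /\
                    forall N', identifiable k N' -> (N <= N')%N]%classic.

Lemma identifiable_card k : (0 < k)%N -> identifiable k #|T|.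
Proof.
move=> k_gt0.
pose r := fun u v : T => (#|below v| <= #|below u|)%N.
pose e := sort r (enum T).
pose s := foldr (fun v s0 => Query v (Announce (below v)) s0)
                (Announce finset.set0).
have r_tr : transitive r by move=> v u w uv vw; exact: leq_trans vw uv.
have e_sorted : sorted r e by apply: sort_sorted => u v; exact: leq_total.
have e_mem v : v \in e by rewrite mem_sort mem_enum.
have e_size : size e = #|T| by rewrite size_sort cardE.
exists (s e) => mu mu_ideal.
rewrite -e_size.
have : forall v, v \in mu -> v \in e by [].
clear e_mem e_size.
elim: e e_sorted => [|v e IHe] e_sorted mu_e /=.
  split=> //; case: mu_ideal => [-> //|[v mu_v]].
  by have := mu_e v; rewrite mu_v inE lexx => /(_ isT).
case: ifPn => [v_mu|v_nmu] /=.
  split=> //; case: mu_ideal => [mu0|[w mu_w]].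
    by move: v_mu; rewrite mu0 inE.
  rewrite mu_w; congr below; apply/eqP.
  have v_le_w : (v <= w)%O by move: v_mu; rewrite mu_w inE.
  rewrite eq_le v_le_w /=; apply: contraT => w_nle_v.
  have /mu_e : w \in mu by rewrite mu_w inE.
  rewrite inE => /orP[/eqP w_v|w_e]; first by rewrite w_v lexx in w_nle_v.
  move: e_sorted; rewrite /= (path_sortedE r_tr) => /andP[/allP/(_ _ w_e)].
  rewrite /r leqNgt => /negP[]; apply: proper_card; apply/properP; split.
    by apply/fintype.subsetP => u; rewrite !inE => /le_trans; exact.
  by exists w; rewrite !inE ?lexx.
have [||? ? ?] := IHe; first exact: path_sorted e_sorted.
  move=> u u_mu; move: (mu_e _ u_mu); rewrite inE => /orP[/eqP u_v|//].
  by rewrite -u_v u_mu in v_nmu.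
by split.
Qed.

Lemma query_numberP k : (0 < k)%N ->
  identifiable k (query_number k) /\
  forall N, identifiable k N -> (query_number k <= N)%N.
Proof.
move=> k_gt0; rewrite /query_number.
have ex : exists N, `[< identifiable k N >].
  by exists #|T|; apply/asboolP; exact: identifiable_card.
have [N /asboolP N_id N_min] := ex_minnP ex.
case: xgetP => [M _ []//|/(_ N)[]].
by split=> // N' /asboolP/N_min.
Qed.

End HiddenIdeal.

Arguments query_number {d} T k.

Section LtreeShape.
Variables (l n : nat).
Implicit Types (u v w : ltree l n).

Definition level v : nat := #|below v|.

Lemma levelE v : level v = (size (val v)).+1.
Proof.
pose pre (i : 'I_(size (val v)).+1) : ltree l n := insubd v (take i (val v)).
have preE i : val (pre i) = take i (val v).
  rewrite val_insubd ifT // size_take_min.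
  by rewrite (leq_trans (geq_minr _ _)) // size_bseq.
rewrite /level -[RHS]card_ord -(@card_in_imset _ _ pre (mem predT)) //; last first.
  have szE (i : 'I_(size (val v)).+1) : size (val (pre i)) = i.
    by rewrite preE size_takel // -ltnS ltn_ord.
  move=> i j _ _ /(congr1 (fun u => size (val u))).
  by rewrite (szE i) (szE j) => /ord_inj.
apply: eq_card => u; rewrite inE; apply/idP/imsetP => [|[i _ ->]]; last first.
  by rewrite ltree_leE preE prefix_take.
move=> u_v; have u_s : (size (val u) < (size (val v)).+1)%N.
  by rewrite ltnS size_prefix.
exists (Ordinal u_s) => //; apply: val_inj; rewrite preE /=.
by move: u_v; rewrite ltree_leE prefixE => /eqP.
Qed.

Lemma card_level t : (0 < t <= n)%N ->
  #|[set v : ltree l n | level v == t]| = (l ^ t.-1)%N.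
Proof.
case/andP; case: t => // t _ t_n /=.
have t_n' : (t <= n.-1)%N by rewrite -ltnS (ltn_predK t_n).
have node_subproof (x : t.-tuple 'I_l) : (size x <= n.-1)%N by rewrite size_tuple.
pose node x : ltree l n := Bseq (node_subproof x).
have <- : #|{: t.-tuple 'I_l}| = (l ^ t)%N by rewrite card_tuple card_ord.
rewrite -(@card_imset _ _ node); last first.
  by move=> x y /(congr1 val)/= xy; apply: val_inj.
apply: eq_card => v; rewrite inE levelE eqSS; apply/idP/imsetP => [v_t|[x _ ->]].
  by exists (Tuple v_t) => //; apply: val_inj.
by rewrite /= size_tuple.
Qed.

Lemma card_covers v : (level v < n)%N ->
  #|[set w : ltree l n | (v < w)%O &&
      [forall u : ltree l n, ~~ ((v < u)%O && (u < w)%O)]]| = l.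
Proof.
rewrite levelE => v_n.
have v_n' : (size (val v) < n.-1)%N by rewrite -ltnS (ltn_predK v_n).
have child_subproof i : (size (rcons (val v) i) <= n.-1)%N by rewrite size_rcons.
pose child i : ltree l n := Bseq (child_subproof i).
have ltE u w : (u < w)%O = (size (val u) < size (val w))%N && (u <= w)%O.
  rewrite lt_neqAle; have [u_w|] := boolP (u <= w)%O; rewrite ?andbF // !andbT.
  rewrite ltn_neqAle size_prefix // andbT; congr (~~ _).
  apply/eqP/eqP => [->//|s_uw]; apply: val_inj => /=.
  by move: u_w; rewrite ltree_leE prefixE s_uw take_size => /eqP.
rewrite -[RHS]card_ord -(@card_imset _ _ child); last first.
  by move=> i j /(congr1 val)/= /rcons_inj[].
apply: eq_card => w; rewrite inE; apply/andP/imsetP => [[]|[i _ ->]].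
  rewrite ltE ltree_leE => /andP[s_vw /prefixP[[|i s] w_v]].
    by rewrite w_v cats0 ltnn in s_vw.
  rewrite -cat_rcons in w_v.
  move=> /forallP/(_ (child i)); rewrite !ltE /= size_rcons ltnSn.
  rewrite !ltree_leE /= prefix_rcons w_v prefix_prefix andbT /=.
  rewrite size_cat size_rcons -addn1 leq_add2l -leqNgt leqn0 => /nilP s0.
  by exists i => //; apply: val_inj; rewrite /= w_v s0 cats0.
rewrite ltE /= size_rcons ltnSn ltree_leE /= prefix_rcons.
split=> //; apply/forallP => u; rewrite !ltE /= size_rcons ltnS.
by apply/negP => /andP[/andP[vu _] /andP[uv _]]; move: vu; rewrite ltnNge uv.
Qed.

Lemma below_chain v u w : u \in below v -> w \in below v -> (u >=< w)%O.
Proof.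
rewrite !inE /Order.comparable !ltree_leE !prefixE => /eqP u_v /eqP w_v.
have [uw|/ltnW wu] := leqP (size (val u)) (size (val w)).
  by rewrite -w_v take_takel // u_v eqxx.
by rewrite -[X in _ || (take _ X == _)]u_v take_takel // w_v eqxx orbT.
Qed.

End LtreeShape.

Local Open Scope ring_scope.

(* Num.ceil is int-valued, hence the absolute value (of a nonnegative integer)
   in the range of the first sum and the int exponent ^ in the second one.
   For l = 1 the value is ceil(n / k) + k - 1, which is unbounded although
   l ^ (n / k) = 1: an upper bound by M * l ^ (n / k) requires 1 < l. *)
Definition fbound (R : realType) (k l n : nat) : R :=
  \sum_(0 <= i < `|Num.ceil (n%:R / k%:R : R)|%N) l%:R ^+ i
  + \sum_(1 <= j < k) l%:R ^ Num.ceil ((n%:R - j%:R) / k%:R : R).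

(* Main.v *)
(** Upper bound: with gaps t_j = ceil((n - j) / k), which satisfy
    t_0 + ... + t_(k-1) = n and t_j <= t_0, spend the j-th stage (1 <= j < k) on
    querying all nodes t_j levels below the last positive node. A stage without
    a positive answer leaves less than t_j <= t_0 unexplored levels, which are
    exhausted one node at a time from the bottom up, at the cost of one positive
    answer; so are the t_0 levels left after k - 1 positive stages.

    Lower bound: a strategy with at most N queries and k positive answers has at
    most (N + 1) ^ k outcomes, while the tree has more than l ^ (n - 1) ideals. *)
Require Import Defs.
From mathcomp Require Import all_boot all_order all_algebra zify.
From mathcomp Require Import all_classical all_reals all_analysis.
Import Order.TTheory GRing.Theory Num.Theory.
Import numFieldNormedType.Exports.

(** * Solvability for classes of sets, and counting of outcomes *)

Section Solvable.
Context {d : Order.disp_t} {T : finPOrderType d}.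
Implicit Types (C D : {set T} -> Prop) (mu : {set T}) (s : strategy T).

(** Replaces the ideals in [identifiable] by an arbitrary class [C], which can record what earlier
    answers have revealed. *)
Definition solvable k N C : Prop := exists s, forall mu, C mu ->
  [/\ announced s mu = mu, (size (answers s mu) <= N)%N &
      (count id (answers s mu) <= k)%N].

Lemma solvable_sub {k k' N N' C D} : (k <= k')%N -> (N <= N')%N ->
  (forall mu, D mu -> C mu) -> solvable k N C -> solvable k' N' D.
Proof.
move=> kk' NN' DC [s sC]; exists s => mu /DC/sC[-> szN ck].
by split; [|exact: leq_trans NN'|exact: leq_trans kk'].
Qed.

Lemma solvable_singleton C A : (forall mu, C mu -> mu = A) -> solvable 0 0 C.
Proof. by move=> CA; exists (Announce A) => mu /CA ->. Qed.

(** The elements of [e] are queried in turn until the first positive answer; [N] further queries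
    suffice in either outcome. *)
Lemma solvable_query_seq k N C (e : seq T) :
  (forall v, v \in e -> solvable k N (fun mu => C mu /\ v \in mu)) ->
  solvable k.+1 N (fun mu => C mu /\ forall v, v \in e -> v \notin mu) ->
  solvable k.+1 (size e + N) C.
Proof.
elim: e C => [|v e IHe] C pos neg.
  by apply: solvable_sub neg => // mu Cmu; split.
have [s1 s1P] : solvable k N (fun mu => C mu /\ v \in mu).
  by apply: pos; rewrite mem_head.
have [|| s0 s0P] := IHe (fun mu => C mu /\ v \notin mu).
- move=> w we; apply: solvable_sub (pos w _) => //.
    by move=> mu [[]].
  by rewrite inE we orbT.
- apply: solvable_sub neg => // mu [[Cmu vmu] emu]; split=> // w.
  by rewrite inE => /predU1P[->//|]; exact: emu.
exists (Query v s1 s0) => mu Cmu /=; case: ifPn => vmu /=.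
- have [-> szN ck] := s1P mu (conj Cmu vmu).
  by split=> //; rewrite addSn ltnS (leq_trans szN)// leq_addl.
- by have [-> szN ck] := s0P mu (conj Cmu vmu); split.
Qed.

(* The answers determine the set, and at most (N + 1) ^ k bit sequences have
   length at most N and at most k ones. *)
Lemma solvable_card k N (A : {set {set T}}) :
  solvable k N (fun mu => mu \in A) -> (#|A| <= N.+1 ^ k)%N.
Proof.
case=> s; elim: s k N A => [B|v s1 IH1 s0 IH0] k N A sA.
  apply: (@leq_trans 1); last by rewrite expn_gt0.
  rewrite -(cards1 B); apply/subset_leq_card/fintype.subsetP => mu /sA[/= <-].
  by rewrite inE.
have [->|[mu0 mu0A]] := set_0Vmem A; first by rewrite cards0.
have [_ + _] := sA _ mu0A; case: N sA => // N sA _.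
pose A1 := [set mu in A | v \in mu]; pose A0 := [set mu in A | v \notin mu].
have -> : #|A| = (#|A1| + #|A0|)%N.
  rewrite -(cardsID A1); congr (_ + _)%N; apply: eq_card => mu; rewrite !inE.
    by case: (mu \in A).
  by case: (mu \in A); rewrite ?andbT ?andbF.
have le0 : (#|A0| <= N.+1 ^ k)%N.
  by apply: IH0 => mu; rewrite inE => /andP[/sA/= + /negPf vmu]; rewrite vmu.
have le1 : (#|A1| <= if k is k'.+1 then N.+1 ^ k' else 0)%N.
  case: k sA le0 => [|k] sA _.
    rewrite leqn0 cards_eq0; apply/eqP/setP => mu; rewrite !inE.
    by apply/negP => /andP[/sA/= + vmu]; rewrite vmu => -[].
  by apply: IH1 => mu; rewrite inE => /andP[/sA/= + vmu]; rewrite vmu.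
apply: leq_trans (leq_add le1 le0) _; case: {sA le0 le1} k => // k.
(* The sum is [N.+1 ^ k + N.+1 ^ k.+1 = N.+2 * N.+1 ^ k], to be compared with [N.+2 ^ k.+1]. *)
rewrite /= expnS -mulSn expnS leq_mul2l /=.
by case: k => // k; rewrite leq_exp2r.
Qed.

Lemma below_inj : injective (@below d T).
Proof.
move=> u v uv; apply/le_anti/andP; split.
  by have : u \in below u; [rewrite inE | rewrite uv inE].
by have : v \in below v; [rewrite inE | rewrite -uv inE].
Qed.

End Solvable.

(** * Query strategies on the tree *)

Section Tree.
Context {l n : nat}.
Local Notation tree := (ltree l n).
Implicit Types (p u v w : tree) (mu : {set tree}) (c : bool).

(* If c is false, then nothing is known to be positive: p is then the root and
   is used only to locate the queries. *)
Definition candidate c p b mu : Prop :=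
  [/\ is_ideal mu, forall u, u \in mu -> (size (val u) < b)%N & c -> p \in mu].

Definition descendants p t : {set tree} :=
  [set w : tree | (p <= w)%O && (size (val w) == size (val p) + t)%N].

Lemma card_descendants p t : (#|descendants p t| <= l ^ t)%N.
Proof.
pose ext (x : t.-tuple 'I_l) : tree := insubd p (val p ++ x).
have sub : descendants p t \subset ext @: [set: t.-tuple 'I_l].
  apply/fintype.subsetP => w; rewrite inE ltree_leE.
  move=> /andP[/prefixP[x wx] /eqP szw].
  have szx : size x == t by rewrite -(eqn_add2l (size (val p))) -szw wx size_cat.
  apply/imsetP; exists (Tuple szx) => //; apply: val_inj.
  by rewrite val_insubd /= -wx size_bseq.
apply: leq_trans (subset_leq_card sub) (leq_trans (leq_imset_card _ _) _).
by rewrite cardsT card_tuple card_ord.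
Qed.

Lemma ideal_down {mu u v} : is_ideal mu -> (u <= v)%O -> v \in mu -> u \in mu.
Proof. by case=> [|[w]] ->; rewrite !inE// => uv /(le_trans uv). Qed.

Lemma ideal_chain {mu u v} : is_ideal mu -> u \in mu -> v \in mu -> (u >=< v)%O.
Proof. by case=> [|[w]] ->; [rewrite inE | exact: below_chain]. Qed.

Lemma ltree_le_size {p v} : (p <= v)%O -> (size (val v) <= size (val p))%N -> p = v.
Proof.
rewrite ltree_leE prefixE => /eqP + szvp; rewrite take_oversize// => vp.
by apply: val_inj; rewrite /= vp.
Qed.

Lemma candidate_below {p mu} : candidate true p (size (val p)).+1 mu -> mu = below p.
Proof.
case=> -[->|[v ->]] szp /(_ isT); first by rewrite inE.
rewrite inE => pv; congr below; apply/esym/ltree_le_size => //.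
by rewrite -ltnS szp// inE.
Qed.

(** If [mu] has an element of length at least [size (val p) + t], its prefix of exactly that length
    is in [mu] too. As [mu] is a chain, or [p] is the root, this prefix descends from [p], so it is
    among the queried nodes. *)
Lemma solvable_query_level c p t b k N : c || (val p == [::]) ->
  (forall w, w \in descendants p t -> solvable k N (candidate true w b)) ->
  solvable k.+1 N (candidate c p (size (val p) + t)) ->
  solvable k.+1 (l ^ t + N) (candidate c p b).
Proof.
move=> cp pos neg.
suff H : solvable k.+1 (size (enum (descendants p t)) + N) (candidate c p b).
  by apply: solvable_sub H => //; rewrite -cardE leq_add2r card_descendants.
apply: solvable_query_seq => [w|].
  rewrite mem_enum => /pos sw; apply: solvable_sub sw => // mu [[mui szb _] wmu].
  by split.
apply: solvable_sub neg => // mu [[mui szb cpmu] negmu]; split=> // u umu.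
rewrite ltnNge; apply/negP => szu.
have szw : (size (take (size (val p) + t) (val u)) <= n.-1)%N.
  by rewrite (leq_trans _ (size_bseq u))// size_take_min geq_minr.
pose w : tree := Bseq szw.
have wu : (w <= u)%O by rewrite ltree_leE prefix_take.
have pu : (p <= u)%O.
  have [pmu|p0] := orP cp; last by rewrite ltree_leE (eqP p0) prefix0s.
  have [//|up] := orP (ideal_chain mui (cpmu pmu) umu).
  suff -> : u = p by [].
  by apply: ltree_le_size => //; apply: leq_trans szu; exact: leq_addr.
have /negmu/negP : w \in enum (descendants p t).
  rewrite mem_enum inE /= size_takel// eqxx andbT.
  move: pu; rewrite !ltree_leE !prefixE /= => pu.
  by rewrite take_takel// leq_addr.
by apply; exact: ideal_down wu umu.
Qed.

(** Levels are queried from the deepest up, so a positive node [w] leaves only [below w]. The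
    boolean [c] is the lower summation index: a [p] known to be positive is not queried again. *)
Lemma solvable_brute c p t : c || (val p == [::]) ->
  solvable 1 (\sum_(c <= i < t) l ^ i) (candidate c p (size (val p) + t)).
Proof.
move=> cp; elim: t => [|t IHt].
  apply: (solvable_sub _ _ (fun mu => id) (@solvable_singleton _ _ _ finset.set0 _)) => //.
  rewrite addn0 => mu [mui szp cmu]; move: cp => /orP[/cmu/szp|/eqP p0].
    by rewrite ltnn.
  by apply/setP => u; rewrite inE; apply/negP => /szp; rewrite p0.
have [/andP[c1 /eqP t0]|ct] := boolP (c && (t == 0%N)).
  rewrite c1 t0 addn1.
  apply: (solvable_sub _ _ (fun mu => id) (@solvable_singleton _ _ _ (below p) _)) => //.
  by move=> mu /candidate_below.
rewrite big_nat_recr /=; last by move: ct; case: (c); case: (t).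
rewrite addnC; apply: solvable_query_level => // w.
rewrite inE => /andP[_ /eqP szw].
apply: (solvable_sub _ _ (fun mu => id) (@solvable_singleton _ _ _ (below w) _)) => //.
by move=> mu; rewrite addnS -szw => /candidate_below.
Qed.

Lemma solvable_staged (ts : seq nat) t c p :
  all (fun i => i <= t)%N ts -> c || (val p == [::]) ->
  solvable (size ts).+1 (\sum_(i <- ts) l ^ i + \sum_(c <= i < t) l ^ i)
    (candidate c p (size (val p) + (sumn ts + t))).
Proof.
elim: ts c p => [|i ts IHts] c p; first by rewrite big_nil => _; exact: solvable_brute.
move=> /= /andP[it tst] cp; rewrite big_cons -addnA.
apply: solvable_query_level => // [w|].
  rewrite inE => /andP[_ /eqP szw]; rewrite -addnA addnA -szw.
  apply: solvable_sub (IHts true w tst isT) => //; rewrite leq_add2l.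
  case: c {cp} => //=; case: (t) => [|t']; first by rewrite !big_geq.
  by rewrite [leqRHS]big_ltn// leq_addl.
(* After negative answers [i] levels remain; since [i <= t], the sum reserved for [t] levels covers
   them. *)
apply: solvable_sub (solvable_brute c p i cp) => //.
apply: leq_trans (leq_addl _ _); have [ci|/ltnW ic] := leqP c i.
  by rewrite [leqRHS](big_cat_nat (n := i))//= leq_addr.
by rewrite big_geq.
Qed.

End Tree.

Lemma identifiable_staged l n (ts : seq nat) t :
  (n.-1 < sumn ts + t)%N -> all (fun i => i <= t)%N ts ->
  identifiable (ltree l n) (size ts).+1
    (\sum_(i <- ts) l ^ i + \sum_(0 <= i < t) l ^ i).
Proof.
move=> nt tst; pose root : ltree l n := [bseq].
apply: solvable_sub (solvable_staged ts t false root tst isT) => // mu mui.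
by split=> // u _; apply: leq_ltn_trans (size_bseq u) _.
Qed.

(** * Ceilings and bounds in natural numbers *)

(** An instance of Hermite's identity, each summand being the ceiling of [(n - j) / k]. Raising [n]
    by one shifts the summands by one index, drops [n %/ k] and adds [n %/ k + 1]. *)
Lemma sum_cdiv k n : (0 < k)%N -> (\sum_(0 <= j < k) ((n + k.-1 - j) %/ k) = n)%N.
Proof.
case: k => // k _; elim: n => [|n IHn] /=.
  by rewrite big_nat big1// => j jk; rewrite divn_small//; lia.
rewrite big_nat_recl//= -[in RHS]IHn big_nat_recr//= subn0.
have -> : (n.+1 + k = n + k.+1)%N by lia.
rewrite divnDr// divnn/= addnC addnA addnK addn1 addnS; congr (_.+1).
Qed.

(** The value of [fbound] as a natural number; [j < k] keeps the subtraction from truncating. *)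
Definition nbound k l n : nat :=
  (\sum_(0 <= i < (n + k.-1) %/ k) l ^ i
   + \sum_(1 <= j < k) l ^ ((n + k.-1 - j) %/ k))%N.

Lemma query_number_le k l n : (0 < k)%N -> (0 < n)%N ->
  (query_number (ltree l n) k <= nbound k l n)%N.
Proof.
move=> k0 n0; apply: (query_numberP _ k0).2.
pose ts := [seq ((n + k.-1 - j) %/ k)%N | j <- index_iota 1 k].
have -> : k = (size ts).+1 by rewrite size_map size_iota; lia.
have -> : nbound (size ts).+1 l n =
    (\sum_(i <- ts) l ^ i + \sum_(0 <= i < (n + k.-1) %/ k) l ^ i)%N.
  rewrite /nbound addnC [in RHS]big_map size_map size_iota.
  by have -> : (k - 1).+1 = k by lia.
apply: identifiable_staged.
  rewrite sumnE big_map addnC.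
  have := sum_cdiv k n k0; rewrite big_ltn// subn0 => ->; lia.
by apply/allP => _ /mapP[j _ ->]; apply: leq_div2r; exact: leq_subr.
Qed.

(** The ideals generated by the [l ^ n.-1] leaves, together with the empty one, give the strict
    inequality. *)
Lemma query_number_gt k l n : (0 < k)%N -> (0 < n)%N ->
  (l ^ n.-1 < (query_number (ltree l n) k).+1 ^ k)%N.
Proof.
move=> k0 n0; have [s sP] := (query_numberP (ltree l n) k0).1.
pose A := finset.set0 |: (@below _ (ltree l n) @: [set: ltree l n]).
have : (#|A| <= (query_number (ltree l n) k).+1 ^ k)%N.
  apply: solvable_card; exists s => mu muA; apply: sP.
  move: muA; rewrite !inE => /orP[/eqP->|/imsetP[v _ ->]]; first by left.
  by right; exists v.
apply: leq_trans; rewrite cardsU1 card_imset; last exact: below_inj.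
have -> : finset.set0 \notin (@below _ (ltree l n) @: [set: ltree l n]).
  apply/imsetP => -[v _ /setP/(_ v)].
  by rewrite !inE lexx.
rewrite add1n ltnS cardsT -(@card_level l n n) ?n0 ?leqnn//.
exact: max_card.
Qed.

Lemma expn_le_query_number k l n : (0 < k)%N -> (0 < l)%N -> (0 < n)%N ->
  (l ^ n <= (2 * l * query_number (ltree l n) k) ^ k)%N.
Proof.
move=> k0 l0 n0; have := @query_number_gt k l n k0 n0.
set q := query_number _ _ => lq.
have q0 : (0 < q)%N.
  case: q lq => //; rewrite exp1n ltnS leqn0 expn_eq0.
  by rewrite eqn0Ngt l0.
(* One factor [l] is at most [l ^ k], and [q + 1 <= 2 * q]; hence the constant [2 * l]. *)
rewrite -(prednK n0) expnS mulnAC mulnC expnMn leq_mul//.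
  by apply: leq_trans (ltnW lq) _; rewrite leq_exp2r//; lia.
by rewrite -[leqLHS]expn1 leq_pexp2l.
Qed.

(** The induction rests on [2 * l ^ t <= l * l ^ t]; for [l = 1] the sum would be [t]. *)
Lemma sum_expn_le l t : (1 < l)%N -> (\sum_(0 <= i < t) l ^ i <= l ^ t)%N.
Proof.
move=> l1; elim: t => [|t IHt]; first by rewrite big_nil.
rewrite big_nat_recr//= expnS (leq_trans (leq_add IHt (leqnn _)))//.
by rewrite addnn -mul2n leq_mul2r l1 orbT.
Qed.

Lemma nbound_le k l n : (0 < k)%N -> (1 < l)%N ->
  (nbound k l n <= k * l ^ ((n + k.-1) %/ k))%N.
Proof.
move=> k0 l1; rewrite -{2}(prednK k0) mulSn leq_add ?sum_expn_le//.
rewrite -subn1 -sum_nat_const_nat; apply: leq_sum => j _.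
by rewrite leq_pexp2l ?leq_div2r ?leq_subr//; lia.
Qed.

(** * Passage to real exponents *)

Local Open Scope ring_scope.

Lemma ceil_divB (R : realType) (k n j : nat) : (j < k)%N ->
  Num.ceil ((n%:R - j%:R) / k%:R : R) = Posz ((n + k.-1 - j) %/ k).
Proof.
move=> jk; have k0 : 0 < k%:R :> R by rewrite ltr0n; lia.
set q := ((n + k.-1 - j) %/ k)%N.
(* These are [q - 1 < (n - j) / k <= q] cleared of denominators. *)
have [h1 h2] : (n <= q * k + j /\ q * k + j < n + k)%N.
  have := divn_eq (n + k.-1 - j) k; have := @ltn_pmod (n + k.-1 - j) k.
  by rewrite -/q; lia.
apply: ceil_def; apply/andP; split; rewrite ?rmorphB /=.
  rewrite ltr_pdivlMr// mulrBl mul1r ltrBrDr addrAC ltrBlDr.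
  by rewrite -natrM -!natrD ltr_nat.
by rewrite ler_pdivrMr// lerBlDr -natrM -natrD ler_nat.
Qed.

Lemma fboundE (R : realType) (k l n : nat) : (0 < k)%N ->
  fbound R k l n = (nbound k l n)%:R.
Proof.
move=> k0; rewrite /fbound /nbound natrD !natr_sum; congr (_ + _).
  have := @ceil_divB R k n 0%N k0; rewrite subr0 subn0 => -> /=.
  by apply: eq_bigr => i _; rewrite natrX.
by apply: eq_big_nat => j /andP[_ jk]; rewrite ceil_divB// natrX.
Qed.

Lemma fbound_le (R : realType) (k l n : nat) : (0 < k)%N -> (1 < l)%N ->
  fbound R k l n <= (k * l)%:R * l%:R `^ (n%:R / k%:R).
Proof.
move=> k0 l1; have kR : 0 < k%:R :> R by rewrite ltr0n.
rewrite fboundE//; apply: le_trans (_ : (k * l ^ ((n + k.-1) %/ k))%:R <= _).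
  by rewrite ler_nat nbound_le.
rewrite !natrM -mulrA ler_wpM2l// natrX -powR_mulrn//.
(* Rounding up adds less than 1 to the exponent, which the factor [l] of the constant absorbs. *)
rewrite -{2}[l%:R](@powRr1 R)// -powRD; last by rewrite pnatr_eq0; apply/implyP; lia.
apply: ler_powR; first by rewrite ler1n; lia.
rewrite -(ler_pM2r kR) mulrDl mul1r divfK ?gt_eqF// -natrM -natrD ler_nat.
by have := leq_trunc_div (n + k.-1) k; lia.
Qed.

Lemma query_number_ge (R : realType) (k l n : nat) :
  (0 < k)%N -> (0 < l)%N -> (0 < n)%N ->
  (2 * l)%:R^-1 * l%:R `^ (n%:R / k%:R) <= (query_number (ltree l n) k)%:R :> R.
Proof.
move=> k0 l0 n0; have kR : k%:R != 0 :> R by rewrite pnatr_eq0 -lt0n.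
rewrite ler_pdivrMl ?ltr0n ?muln_gt0// -natrM.
have := expn_le_query_number k l n k0 l0 n0; set x := (2 * l * _)%N.
rewrite -(ler_nat R) !natrX => lx.
rewrite powRrM powR_mulrn// -[leRHS](@powRr1 R)// -[X in _ <= _ `^ X](divff kR).
by rewrite powRrM powR_mulrn// ge0_ler_powR ?invr_ge0// nnegrE exprn_ge0.
Qed.

(** * Asymptotic equivalence *)

Local Open Scope classical_set_scope.
Local Open Scope ring_scope.

(** The relation compares norms eventually: [f] is nonnegative wherever the lower bound holds, and
    the index 0 is discarded. *)
Lemma eqThetaP (R : realType) (f g : nat -> R) (m M : R) : 0 < m -> 0 < M ->
  (forall n, 0 <= g n) ->
  (forall n, (0 < n)%N -> m * g n <= f n <= M * g n) -> f =Theta_\oo g.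
Proof.
move=> m0 M0 g0 fg; rewrite eqThetaE qualifE; apply/asboolP.
exists (m, M); first by rewrite /= m0.
near=> n; have /andP[lo hi] : m * g n <= f n <= M * g n.
  by apply: fg; near: n; exact: nbhs_infty_gt.
rewrite (ger0_norm (g0 n)) ger0_norm//.
by rewrite (le_trans _ lo)// mulr_ge0// ltW.
Unshelve. all: by end_near. Qed.

Theorem theoremB (R : realType) (k l : nat) (k_gt0 : (0 < k)%N)
    (l_gt0 : (0 < l)%N) :
  (exists m M : R, [/\ 0 < m, 0 < M &
    forall n : nat, (0 < n)%N ->
      [/\ m * l%:R `^ (n%:R / k%:R) <= (query_number (ltree l n) k)%:R,
          (query_number (ltree l n) k)%:R <= fbound R k l n &
          (1 < l)%N -> fbound R k l n <= M * l%:R `^ (n%:R / k%:R)]]) /\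
  ((1 < l)%N ->
    (fun n : nat => (query_number (ltree l n) k)%:R : R)
      =Theta_\oo (fun n : nat => l%:R `^ (n%:R / k%:R) : R) /\
    (fun n : nat => fbound R k l n)
      =Theta_\oo (fun n : nat => l%:R `^ (n%:R / k%:R) : R)).
Proof.
have lo n : (0 < n)%N -> _ := query_number_ge R k l n k_gt0 l_gt0.
have mid n : (0 < n)%N -> (query_number (ltree l n) k)%:R <= fbound R k l n.
  by move=> n0; rewrite fboundE// ler_nat query_number_le.
have hi n : (1 < l)%N -> _ := fbound_le R k l n k_gt0.
have m0 : 0 < (2 * l)%:R^-1 :> R by rewrite invr_gt0 ltr0n muln_gt0.
have M0 : 0 < (k * l)%:R :> R by rewrite ltr0n muln_gt0 k_gt0.
split.
  exists (2 * l)%:R^-1, (k * l)%:R; split=> // n n0.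
  by split; [exact: lo | exact: mid | exact: hi].
(* Through [mid], the query number inherits the upper bound of [fbound], and [fbound] the lower
   bound of the query number. *)
move=> l1; split; apply: (@eqThetaP R _ _ _ _ m0 M0) => n; rewrite ?powR_ge0//.
  by move=> n0; rewrite lo// (le_trans (mid n n0))// hi.
by move=> n0; rewrite hi// andbT (le_trans (lo n n0))// mid.
Qed.
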